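(* Let $X_i$, $i\ge 0$, be continua, let $f_i\colon X_i\to X_{i-1}$, $i\ge 1$, be continuous surjections, and let $\Psi\colon \varprojlim(X_i,f_i)\to\varprojlim(X_i,f_i)$ be a continuous function. For $i\ge 0$ define the (possibly set-valued) function $\psi_i\colon X_i\to 2^{X_i}$ by $\psi_i(x)=\pi_i(\Psi(\pi_i^{-1}(x)))$. Then $$\mathrm{Ent}(\Psi)\le\liminf_{i\to\infty}\mathrm{Ent}(\psi_i).$$
   Context: A continuum is a compact, connected, metric space. $\varprojlim(X_i,f_i)=\{(x_0,x_1,x_2,\ldots): f_i(x_i)=x_{i-1},\ i\ge 1\}\subset\prod_{i\ge 0}X_i$ with the product topology; $\pi_i$ denotes the coordinate projection onto $X_i$. The metric $d_i$ on $X_i$ has $\mathrm{diam}(X_i)=1$, and the metric on the inverse limit is $d(x,y)=\sum_{i\ge 0}d_i(x_i,y_i)/2^i$. Set-valued functions and entropy. $2^X$ is the set of non-empty closed subsets of $X$. A set-valued function $F\colon X\to 2^X$ (also written $F\colon X\to X$) is assumed to have closed graph $\{(x,y):y\in F(x)\}$; a continuous map is regarded as a set-valued function with singleton values. An $n$-orbit of $F$ is a tuple $(x_1,\ldots,x_n)$ with $x_{i+1}\in F(x_i)$ for $1\le i<n$; $Orb_n(F)$ is the set of $n$-orbits. A set $S\subset Orb_n(F)$ is $(n,\varepsilon)$-separated if for any two distinct $(x_1,\ldots,x_n),(y_1,\ldots,y_n)\in S$ there is $i\in\{1,\ldots,n\}$ with $d_X(x_i,y_i)>\varepsilon$. Let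 $s_{n,\varepsilon}(F)$ be the largest cardinality of an $(n,\varepsilon)$-separated set. Then $\mathrm{Ent}(F)=\lim_{\varepsilon\to 0}\limsup_{n\to\infty}\frac1n\log s_{n,\varepsilon}(F)\in[0,\infty]$. *)

(* Defs.v *)
From HB Require Import structures.
From mathcomp Require Import all_boot all_order all_algebra.
From mathcomp Require Import all_classical all_reals all_analysis.
Import Order.TTheory GRing.Theory Num.Theory.
Import numFieldNormedType.Exports.

Set Implicit Arguments.
Unset Strict Implicit.
Unset Printing Implicit Defensive.

Local Open Scope classical_set_scope.
Local Open Scope ring_scope.

Section Continuum.
Context {R : realType}.

Definition continuum (T : metricType R) : Prop :=
  compact [set: T] /\ connected [set: T].

Definition diam (T : metricType R) : \bar R :=
  ereal_sup [set (mdist p.1 p.2)%:E | p in [set: T * T]].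

End Continuum.

(* The distance is an explicit argument, so that the entropy on an inverse
   limit is computed with [invlim_dist] and not with the distance of some
   canonical structure on the product. *)
Section Entropy.
Context {R : realType} {T : choiceType}.
Variables (d : T -> T -> R) (F : T -> set T).

Definition Orb (n : nat) : set (n.-tuple T) :=
  [set x | forall i j : 'I_n, j = i.+1 :> nat -> F (tnth x i) (tnth x j)].

Definition separated_orbits (n : nat) (e : R) (S : set (n.-tuple T)) : Prop :=
  S `<=` @Orb n /\
  forall x y, S x -> S y -> x <> y -> exists i, e < d (tnth x i) (tnth y i).

(* [counting S] is the cardinality of S when S is finite and +oo otherwise. *)
Definition max_separated (n : nat) (e : R) : \bar R :=
  ereal_sup [set counting S | S in @separated_orbits n e].

Definition Ent : \bar R :=
  lim (limn_esup (fun n : nat => (n%:R^-1)%:E * lne (max_separated n e))%E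
         @[e --> 0^'+]).

End Entropy.

(* [f i] is the bonding map from the space of index i + 1 to the one of
   index i. *)
Section InverseLimit.
Context {R : realType} {X : nat -> metricType R}.
Variable f : forall i, X i.+1 -> X i.

(* As a type, [invlim] carries the subspace topology of the product topology. *)
Definition invlim : set (prod_topology X) :=
  [set x | forall i, @f i (x i.+1) = x i].

Definition invlim_proj (i : nat) (x : invlim) : X i := set_val x i.

Definition invlim_dist (x y : invlim) : R :=
  limn (series (fun i => mdist (invlim_proj i x) (invlim_proj i y) / 2 ^+ i)).

Definition induced_map (Psi : invlim -> invlim) (i : nat) (x : X i) :
    set (X i) :=
  invlim_proj i @` (Psi @` (invlim_proj i @^-1` [set x])).

End InverseLimit.

(* Main.v *)
Require Import Defs.
From mathcomp Require Import all_boot all_order all_algebra.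
From mathcomp Require Import all_classical all_reals all_analysis.
Import Order.TTheory GRing.Theory Num.Theory.
Import numFieldNormedType.Exports.

Set Implicit Arguments.
Unset Strict Implicit.
Unset Printing Implicit Defensive.

Local Open Scope classical_set_scope.
Local Open Scope ring_scope.

(* If d(x, y) > e on the inverse limit and 2^(1-i) <= e, then the first i + 1
   terms of the series defining d already sum to at least e/2.  They are
   functions of the i-th coordinates alone, uniformly continuous by compactness,
   so d_i(x_i, y_i) > a for some a > 0 depending only on e and i.  Hence the
   i-th projection, which sends Psi-orbits to psi_i-orbits, carries
   (n, e)-separated sets injectively to (n, a)-separated sets; the growth rate
   of Psi at scale e is therefore at most Ent(psi_i) for all large i. *)

Section Counting.
Context {R : realType}.

Lemma counting_ge0 (T : choiceType) (A : set T) : (0 <= counting A :> \bar R)%E.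
Proof. by rewrite /counting; case: ifPn; rewrite ?lee_fin// leey. Qed.

Lemma counting_image_inj (T U : choiceType) (p : T -> U) (A : set T) :
  {in A &, injective p} -> counting (p @` A) = counting A :> \bar R.
Proof.
move=> pinj; rewrite /counting.
have [finA|infA] := pselect (finite_set A).
  rewrite !asboolT//; last exact: finite_image.
  congr (_%:R%:E); rewrite fset_set_image// finmap.card_in_imfset//= => x y.
  by rewrite !in_fset_set//; exact: pinj.
by rewrite !asboolF//= (eq_finite_set (inj_card_eq pinj)).
Qed.

End Counting.

Section LimitInferiorSuperior.
Context {R : realType}.

Lemma le_limn_esup (u v : (\bar R)^nat) :
  (forall n, u n <= v n)%E -> (limn_esup u <= limn_esup v)%E.
Proof.
(* [limn_esup] is an infimum of suprema over the neighbourhoods V of infinity; the same V serves for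
   both sequences. *)
move=> uv; apply: le_ereal_inf_tmp => _ [V Voo <-].
apply: ge_ereal_inf; exists (ereal_sup (u @` V)); first by exists V.
apply: ge_ereal_sup => _ [n Vn <-].
by apply: le_ereal_sup_tmp; exists (v n) => //; exists n.
Qed.

Lemma limn_einf_ge_near (u : (\bar R)^nat) (l : \bar R) :
  (\forall n \near \oo, l <= u n)%E -> (l <= limn_einf u)%E.
Proof.
(* The lower limit is minus the upper limit of [- u], and the set where [l <= u n] is itself a
   neighbourhood of infinity. *)
move=> lu; rewrite leeNr; apply: ge_ereal_inf.
exists (ereal_sup ((\- u)%E @` [set n | l <= u n]%E)).
  by eexists; [exact: lu|].
by apply: ge_ereal_sup => _ [n /= ln <-]; rewrite leeN2.
Qed.

End LimitInferiorSuperior.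

Section EntropyComparison.
Context {R : realType}.

(** The exponential growth rate at one fixed scale [e]; [Ent] is its limit as [e] tends to 0 from
    the right. *)
Definition entropy_at (T : choiceType) (d : T -> T -> R) (F : T -> set T)
    (e : R) : \bar R :=
  limn_esup (fun n => (n%:R^-1)%:E * lne (max_separated d F n e))%E.

Lemma max_separated_ge0 (T : choiceType) (d : T -> T -> R) (F : T -> set T) n e :
  (0 <= max_separated d F n e)%E.
Proof.
apply: le_ereal_sup_tmp; exists (counting (set0 : set (n.-tuple T))).
  by exists set0 => //; split => // ? ?.
exact: counting_ge0.
Qed.

Lemma le_entropy_at (T U : choiceType) (d : T -> T -> R) (F : T -> set T)
    (d' : U -> U -> R) (G : U -> set U) e e' :
  (forall n, max_separated d F n e <= max_separated d' G n e')%E ->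
  (entropy_at d F e <= entropy_at d' G e')%E.
Proof.
move=> le; apply: le_limn_esup => n; apply: lee_wpmul2l.
  by rewrite lee_fin invr_ge0.
by rewrite lee_lne ?in_itv/= ?max_separated_ge0 ?leey.
Qed.

Lemma nonincreasing_entropy_at (T : choiceType) (d : T -> T -> R)
    (F : T -> set T) (e e' : R) :
  e' <= e -> (entropy_at d F e <= entropy_at d F e')%E.
Proof.
move=> ee; apply: le_entropy_at => n; apply: ereal_sup_le => _ [S [SO Ssep] <-].
exists S => //; split=> // x y Sx Sy /(Ssep _ _ Sx Sy)[i xy].
by exists i; exact: le_lt_trans xy.
Qed.

(** Lowering [e] only admits more separated sets, so the limit exists in the extended reals and the
    [lim] in [Ent] is not a default value. *)
Lemma is_cvg_entropy_at (T : choiceType) (d : T -> T -> R) (F : T -> set T) :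
  cvg (entropy_at d F e @[e --> 0^'+]).
Proof.
apply: nonincreasing_at_right_is_cvge; apply: nearW => x a b _ _.
exact: nonincreasing_entropy_at.
Qed.

Lemma entropy_at_le_Ent (T : choiceType) (d : T -> T -> R) (F : T -> set T) e :
  0 < e -> (entropy_at d F e <= Ent d F)%E.
Proof.
move=> e0; apply: lime_ge; first exact: is_cvg_entropy_at.
near=> a; apply: nonincreasing_entropy_at; apply/ltW; near: a.
exact: nbhs_right_lt.
Unshelve. all: by end_near. Qed.

Lemma max_separated_semiconj (T U : choiceType) (d : T -> T -> R)
    (F : T -> set T) (d' : U -> U -> R) (G : U -> set U) (p : T -> U) e e' n :
  (forall u, d' u u <= e') ->
  (forall x y, F x y -> G (p x) (p y)) ->
  (forall x y, e < d x y -> e' < d' (p x) (p y)) ->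
  (max_separated d F n e <= max_separated d' G n e')%E.
Proof.
move=> d'e pFG pd; apply: ereal_sup_le => _ [S [SO Ssep] <-].
pose q (x : n.-tuple T) := [tuple of map p x].
have qsep x y : S x -> S y -> x <> y ->
    exists i, e' < d' (tnth (q x) i) (tnth (q y) i).
  move=> Sx Sy /(Ssep _ _ Sx Sy)[i /pd xy].
  by exists i; rewrite !tnth_map.
exists (q @` S); last first.
  apply: counting_image_inj => x y /set_mem Sx /set_mem Sy qxy.
  (* Distinct orbits with equal images would give [e' < d' u u] for some [u]. *)
  apply: contrapT => /(qsep _ _ Sx Sy)[i].
  by rewrite qxy ltNge d'e.
split=> [_ [x Sx <-] i j ij|_ _ [x Sx <-] [y Sy <-] qxy].
  by rewrite !tnth_map; exact/pFG/SO.
by apply: qsep => // xy; apply: qxy; rewrite xy.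
Qed.

End EntropyComparison.

Section UniformContinuity.
Context {R : realType} {T U : metricType R}.

(** Heine-Cantor, from the near-covering form of compactness. The bounds are non-strict so that the
    contrapositive yields the strict inequalities of separation. *)
Lemma compact_mdist_unif_continuous (f : T -> U) :
  compact [set: T] -> continuous f ->
  forall e, 0 < e -> exists2 a, 0 < a &
    forall x y, mdist x y <= a -> mdist (f x) (f y) <= e.
Proof.
move=> /compact_near_coveringP cT cf e e0.
have : \forall a \near 0^'+, [set: T] `<=`
    (fun a x => forall y, mdist x y <= a -> mdist (f x) (f y) <= e) a.
  apply: cT => x _.
  have /nbhs_ballP[r /= r0 xr] : \forall y \near x, ball (f x) (e / 2) (f y).
    by apply: cf; apply: nbhsx_ballx; rewrite divr_gt0.
  (* Half the radius keeps both [z] and any [y] within [a] of [z] inside the ball of radius [r]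
     about [x]. *)
  exists (ball x (r / 2), [set a : R | a < r / 2]) => /=.
    split; first by apply: nbhsx_ballx; rewrite divr_gt0.
    by apply: nbhs_right_lt; rewrite divr_gt0.
  move=> [z a]/= [xz ar] y zy.
  have fxz : ball (f x) (e / 2) (f z).
    by apply: xr; apply: le_ball xz; rewrite ler_pdivrMr// ler_pMr// ler1n.
  have fxy : ball (f x) (e / 2) (f y).
    apply: xr; rewrite (splitr r); apply: ball_triangle xz _.
    by rewrite ballEmdist/=; exact: le_lt_trans ar.
  have : ball (f z) e (f y).
    by rewrite (splitr e); apply: ball_triangle fxy; exact: ball_sym.
  by rewrite ballEmdist/= => /ltW.
move=> H; near (0 : R)^'+ => a; exists a.
  by near: a; exact: nbhs_right_gt.
by move=> x; apply: (near H a).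
Unshelve. all: by end_near. Qed.

End UniformContinuity.

Section InverseLimitDistance.
Context {R : realType} {X : nat -> metricType R}.
Variable f : forall i, X i.+1 -> X i.
Hypothesis X_diam : forall i, diam (X i) = 1%:E.

Local Notation dist_series x y :=
  (series (fun i => mdist (invlim_proj i x) (invlim_proj i y) / 2 ^+ i)).

Lemma mdist_le1 i (a b : X i) : mdist a b <= 1.
Proof.
rewrite -lee_fin -(X_diam i); apply: ereal_sup_ubound.
by exists (a, b).
Qed.

(** Distances are at most 1, so the added terms are dominated by a geometric sum; keeping its exact
    value lets the induction telescope. *)
Lemma dist_series_tail (x y : invlim f) n k :
  dist_series x y (n + k)%N <= dist_series x y n + 2 / 2 ^+ n - 2 / 2 ^+ (n + k).
Proof.
elim: k => [|k IH]; first by rewrite addn0 addrK.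
rewrite addnS seriesSr/=.
have -> : 2 / 2 ^+ (n + k).+1 = 2 / 2 ^+ (n + k) - 1 / 2 ^+ (n + k) :> R.
  rewrite exprS invfM mulrA divff ?pnatr_eq0// -mulrBl.
  by congr (_ / _); rewrite -[2]/(1 + 1) addrK.
rewrite opprB addrA -[leRHS]addrA [X in _ <= _ + X]addrC addrA.
by rewrite lerD// ler_wpM2r ?invr_ge0 ?exprn_ge0// mdist_le1.
Qed.

Lemma invlim_dist_le (x y : invlim f) n :
  invlim_dist x y <= dist_series x y n + 2 / 2 ^+ n.
Proof.
have nd : nondecreasing_seq (dist_series x y).
  apply: (@nondecreasing_series _ _ predT 0) => i _ _.
  by rewrite divr_ge0 ?mdist_ge0 ?exprn_ge0.
have bd m : dist_series x y m <= dist_series x y n + 2 / 2 ^+ n.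
  apply: (@le_trans _ _ (dist_series x y (n + m))); first exact/nd/leq_addl.
  apply: le_trans (dist_series_tail _ _ _ _) _.
  by rewrite gerBl divr_ge0 ?exprn_ge0.
apply: limr_le; last exact: nearW.
apply: nondecreasing_is_cvgn nd _.
by exists (dist_series x y n + 2 / 2 ^+ n) => _ [m _ <-].
Qed.

Hypothesis X_compact : forall i, compact [set: X i].
Hypothesis f_continuous : forall i, continuous (@f i).

(** Induction on [i]: points of the limit satisfy [f (x i.+1) = x i], so uniform continuity of [f]
    passes closeness down one coordinate. *)
Lemma dist_series_coord i e : 0 < e -> exists2 a, 0 < a &
  forall x y : invlim f, mdist (invlim_proj i x) (invlim_proj i y) <= a ->
    dist_series x y i.+1 <= e.
Proof.
elim: i e => [|i IH] e e0.
  exists e => // x y xy.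
  by rewrite seriesSr /series/= big_geq// add0r expr0 divr1.
have e20 : 0 < e / 2 by rewrite divr_gt0.
have [a a0 Ha] := IH _ e20.
have [b b0 Hb] := compact_mdist_unif_continuous (@X_compact i.+1)
  (@f_continuous i) a0.
(* [b] keeps the earlier terms below [e / 2] in total; the other bound handles the new term, whose
   weight is at most 1. *)
exists (Num.min b (e / 2)); first by rewrite lt_min b0.
move=> x y; rewrite le_min => /andP[xyb xye].
rewrite seriesSr (splitr e) lerD//.
  apply: Ha.
  have projE (z : invlim f) : f (invlim_proj i.+1 z) = invlim_proj i z.
    exact: (set_valP z i).
  by rewrite -!projE; exact: Hb.
apply: le_trans xye; rewrite ler_pdivrMr ?exprn_gt0// ler_peMr ?mdist_ge0//.
by rewrite exprn_ege1// ler1n.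
Qed.

Lemma invlim_dist_separated e : 0 < e -> \forall i \near \oo, exists2 a, 0 < a &
  forall x y : invlim f, e < invlim_dist x y ->
    a < mdist (invlim_proj i x) (invlim_proj i y).
Proof.
move=> e0; near=> i.
have [a a0 Ha] := @dist_series_coord i _ (divr_gt0 e0 (ltr0n R 2)).
exists a => // x y; rewrite !ltNge; apply: contra => /Ha xy.
apply: le_trans (invlim_dist_le _ _ i.+1) _.
(* Only the tail bound [2 / 2 ^+ i.+1] is left to bring below [e / 2], which holds for large [i]. *)
rewrite (splitr e) lerD//; apply: ltW; near: i.
have : 2 / 2 ^+ i.+1 @[i --> \oo] --> (0 : R).
  have half : `|2^-1 : R| < 1 by rewrite ger0_norm ?invr_ge0// invf_lt1// ltr1n.
  have -> : (fun i => 2 / 2 ^+ i.+1) = geometric (1 : R) 2^-1.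
    apply/funext => i; rewrite /= exprS invfM mulrA divff ?pnatr_eq0//.
    by rewrite exprVn.
  exact: cvg_geometric.
by move=> /cvgrPdist_lt/(_ _ (divr_gt0 e0 (ltr0n R 2))); apply: filterS => i;
  rewrite sub0r normrN; apply: le_lt_trans; exact: ler_norm.
Unshelve. all: by end_near. Qed.

End InverseLimitDistance.

Theorem theorem3p4 (R : realType) (X : nat -> metricType R)
    (f : forall i, X i.+1 -> X i) (Psi : invlim f -> invlim f)
    (X_continuum : forall i, continuum (X i))
    (X_diam : forall i, diam (X i) = 1%:E)
    (f_continuous : forall i, continuous (f i))
    (f_surj : forall i, set_surj [set: X i.+1] [set: X i] (f i))
    (Psi_continuous : continuous Psi) :
  (Ent (@invlim_dist R X f) (fun x => [set Psi x])
     <= limn_einf (fun i => Ent (@mdist R (X i)) (induced_map Psi (i := i))))%E.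
Proof.
apply: lime_le; first exact: is_cvg_entropy_at.
near=> e.
have e0 : 0 < e by near: e; exact: nbhs_right_gt.
apply: limn_einf_ge_near.
have X_compact i : compact [set: X i] by have [] := X_continuum i.
have sep := invlim_dist_separated X_diam X_compact f_continuous e0.
apply: filterS sep => i [a a0 Ha].
(* The scale [a] may shrink with [i]: [Ent] dominates the growth rate at every positive scale. *)
apply: le_trans (entropy_at_le_Ent _ _ a0).
apply: le_entropy_at => n.
apply: (max_separated_semiconj (p := @invlim_proj R X f i)) => //.
- by move=> u; rewrite mdistxx ltW.
(* [x] itself lies in the fibre over its [i]-th coordinate, so it witnesses the orbit step. *)
- by move=> x _ ->; exists (Psi x) => //; exists x.
Unshelve. all: by end_near. Qed.
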